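(* Let $s:\mathbb{C}\to\mathbb{P}^1$ be a meromorphic function, $s\not\equiv\infty$. Write $s=q/q_1$ with $q,q_1$ entire functions without common zeros, and let $g_1$ be an entire function such that, with $g=q_1/e^{g_1}$, the functions $1/g$ and $s$ have the same principal parts, so that $h=s-1/g$ is an entire function whose graph does not meet $\mathrm{graph}(s)$. For every entire function $u$, let $\varphi^u$ be the complex flow of the complete vector field $$Z^u=e^{u(z)}\,[q_1(z)w-q(z)]\,\frac{\partial}{\partial w}.$$ Then the family $\{f^u\}_{u}$, indexed by all entire functions $u$, of holomorphic maps $$f^u(z,t)=\varphi^u(t,z,h(z)),\qquad (z,t)\in\mathbb{C}^2,$$ is a family of fiber-preserving dominating maps from $\mathbb{C}^2$ onto $\mathbb{C}^2\setminus\mathrm{graph}(s)$. To be more precise, $f^u$ is explicitly given by $$f^u(z,t)=\left(z,\ s(z)-\frac{e^{[e^{u(z)}q_1(z)]t}}{g(z)}\right).$$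
   Context: Coordinates are $(z,w)$. $\mathrm{graph}(s)\subset\mathbb{C}^2$ is $\{(z,s(z)): s(z)\neq\infty\}$. The flow $\varphi^u(t,z,w)$ is the value at complex time $t$ of the solution of $Z^u$ starting at $(z,w)$ at time $0$. A holomorphic map $f$ from $\mathbb{C}^2$ to a complex surface $M$ is dominating if its Jacobian determinant is not identically zero; a map $f$ is fiber-preserving if $f(z,t)=(z,\cdot)$. In the explicit formula, the second component is an entire function on $\mathbb{C}^2$, with the values at points where $g(z)=0$ understood by holomorphic extension. An entire function $g_1$ as in the statement exists by the Mittag-Leffler and Weierstrass theorems. *)

(* Defs.v *)
From Stdlib Require Export Reals.
From Coquelicot Require Export Coquelicot.

Open Scope C_scope.

(** Complex exponential, [exp (x + iy) = e^x (cos y + i sin y)]. *)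
Definition cexp (z : C) : C :=
  (exp (fst z) * cos (snd z), exp (fst z) * sin (snd z))%R.

Definition entire (f : C -> C) : Prop :=
  forall z : C, ex_derive (K := C_AbsRing) (V := C_NormedModule) f z.

(** Holomorphic on some neighbourhood of [p], not merely differentiable at
    [p]. *)
Definition holomorphic_near (f : C -> C) (p : C) : Prop :=
  locally p (fun z : C => ex_derive (K := C_AbsRing) (V := C_NormedModule) f z).

Inductive P1 : Type :=
| P1_fin (c : C)
| P1_inf.

(** The point [[a : b]] of the sphere; [P1_div 0 0] is a junk value, to be
    used only when [a] and [b] do not both vanish. *)
Definition P1_div (a b : C) : P1 :=
  if Ceq_dec b 0 then P1_inf else P1_fin (a / b).

(** Meromorphic functions on the plane, as holomorphic maps to the sphere:
    near every point, the map is holomorphic in one of the two standard charts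
    (the second one being [c => 1 / c] around infinity). The constant map
    infinity is not excluded here. *)
Definition meromorphic (s : C -> P1) : Prop :=
  forall p : C, exists k : C -> C, holomorphic_near k p /\
    (locally p (fun z : C => s z = P1_fin (k z)) \/
     locally p (fun z : C => s z = P1_div 1 (k z))).

(** The principal part of [s] at [p] is [c 1 / (z - p) + ... + c n / (z - p)^n];
    it vanishes at points where [s] is holomorphic. The coefficients of [c]
    outside the range [1..n] are irrelevant. *)
Definition is_principal_part (s : C -> P1) (p : C) (n : nat) (c : nat -> C)
  : Prop :=
  exists k : C -> C, holomorphic_near k p /\
    locally' p (fun z : C =>
      s z = P1_fin (sum_n_m (fun i : nat => c i / (z - p) ^ i) 1 n + k z)).

Definition same_principal_parts (s1 s2 : C -> P1) : Prop :=
  forall p : C, exists (n : nat) (c : nat -> C),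
    is_principal_part s1 p n c /\ is_principal_part s2 p n c.

Definition graph (s : C -> P1) : C * C -> Prop :=
  fun p => s (fst p) = P1_fin (snd p).

Notation C2 := (prod_NormedModule C_AbsRing C_NormedModule C_NormedModule).

(** Complex differentiability in the sense of Fréchet: the differential is
    linear over the complex numbers. *)
Definition holomorphic2 {V : NormedModule C_AbsRing} (f : C * C -> V) : Prop :=
  forall p : C * C,
    ex_filterdiff (K := C_AbsRing) (U := C2) f (locally p).

(** [J] is the determinant of the complex Jacobian matrix of [f] at [p]; the
    columns of the matrix are the images of the standard basis vectors under
    the differential [l]. *)
Definition is_jacobian_det (f : C * C -> C * C) (p : C * C) (J : C) : Prop :=
  exists l : C * C -> C * C,
    filterdiff (K := C_AbsRing) (U := C2) (V := C2) f (locally p) l /\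
    J = fst (l (RtoC 1, RtoC 0)) * snd (l (RtoC 0, RtoC 1))
        - fst (l (RtoC 0, RtoC 1)) * snd (l (RtoC 1, RtoC 0)).

(** Dominating maps into a complex surface given as an open subset [M] of
    [C * C], on which the coordinates are global. *)
Definition dominating (f : C * C -> C * C) (M : C * C -> Prop) : Prop :=
  open M /\
  (forall p : C * C, M (f p)) /\
  holomorphic2 (V := C2) f /\
  exists (p : C * C) (J : C), is_jacobian_det f p J /\ J <> 0.

Definition fiber_preserving (f : C * C -> C * C) : Prop :=
  forall p : C * C, fst (f p) = fst p.

Definition maps_onto (f : C * C -> C * C) (M : C * C -> Prop) : Prop :=
  forall p : C * C, M p <-> exists x : C * C, f x = p.

(** Time is complex, and the solution is defined for all times. *)
Definition integral_curve (Z : C * C -> C * C) (gamma : C -> C * C) : Prop :=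
  forall t : C,
    is_derive (K := C_AbsRing) (V := C2) gamma t (Z (gamma t)).

Definition complete_field (Z : C * C -> C * C) : Prop :=
  forall p : C * C, exists gamma : C -> C * C,
    gamma (RtoC 0) = p /\ integral_curve Z gamma.

Definition is_flow (Z : C * C -> C * C) (phi : C -> C * C -> C * C) : Prop :=
  forall p : C * C,
    phi (RtoC 0) p = p /\ integral_curve Z (fun t : C => phi t p).

(** The vector field [e^u (q1 w - q) d/dw], with coordinates [(z, w)]. *)
Definition Zfield (q q1 u : C -> C) : C * C -> C * C :=
  fun p => (RtoC 0, cexp (u (fst p)) * (q1 (fst p) * snd p - q (fst p))).

Definition flow_map (phi : C -> C * C -> C * C) (h : C -> C)
  : C * C -> C * C :=
  fun p => phi (snd p) (fst p, h (fst p)).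

(* Main.v *)
From Stdlib Require Import Lra ClassicalEpsilon.
Require Import Defs.

(** Along a fibre the field is [w' = a w + b] with [a = e^u q1] and
    [b = - e^u q], so the flow is [w + (a w + b) t E (a t)] where
    [E x = (e^x - 1) / x] is entire; this form also covers the zeros of [q1].
    On the graph of [h] one has [q1 h - q = - e^g1], first off the zeros of
    [q1] and then everywhere by continuity, since the principal parts make
    these zeros isolated. Hence the second component [F] satisfies
    [q1 F - q = - e^g1 e^(a t)]: it never vanishes, while the graph of [s] is
    the zero set of [q1 w - q], and surjectivity onto the complement follows
    from that of the exponential onto the nonzero numbers, or from the
    affine dependence on [t] where [q1 = 0]. *)

(** * Complex derivatives by explicit estimates *)

Notation is_cderive :=
  (is_derive (K := C_AbsRing) (V := C_NormedModule)).
Notation ex_cderive :=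
  (ex_derive (K := C_AbsRing) (V := C_NormedModule)).

Lemma is_cderive_eps (f : C -> C) (z l : C) :
  is_cderive f z l <->
  forall eps : R, (0 < eps)%R -> exists delta : R, (0 < delta)%R /\
    forall y : C, (Cmod (y - z) < delta)%R ->
      (Cmod (f y - f z - (y - z) * l) <= eps * Cmod (y - z))%R.
Proof.
split.
- intros [_ H] eps Heps.
  destruct (H z (fun P HP => HP) (mkposreal eps Heps)) as [delta Hd].
  exists delta. split; [apply cond_pos|].
  intros y Hy. exact (Hd y Hy).
- intros H. split.
  + apply (is_linear_scal_l (K := C_AbsRing) (V := C_NormedModule)).
  + intros x Hx.
    (* The domination clause ranges over all limits of the filter [locally z]; the only one is z
       itself. *)
    apply (is_filter_lim_locally_unique (V := AbsRing_NormedModule C_AbsRing))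
      in Hx.
    subst x.
    intros eps. destruct (H eps (cond_pos eps)) as [d [Hd1 Hd2]].
    exists (mkposreal d Hd1). intros y Hy. exact (Hd2 y Hy).
Qed.

Lemma locally_Cmod (p : C) (P : C -> Prop) :
  locally p P <->
  exists delta : R, (0 < delta)%R /\
    forall y : C, (Cmod (y - p) < delta)%R -> P y.
Proof.
rewrite locally_C. split.
- intros [d Hd]. exists d. split; [apply cond_pos | exact Hd].
- intros [d [Hd H]]. exists (mkposreal d Hd). exact H.
Qed.

(** A remainder of order two is negligible against |y - z|. The derivatives of the inverse, of
    [cexp] and of [expm1_div] at 0 all come from such an inequality. *)
Lemma is_cderive_quadratic (f : C -> C) (z l : C) (M delta : R) :
  (0 < delta)%R ->
  (forall y : C, (Cmod (y - z) < delta)%R ->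
     (Cmod (f y - f z - (y - z) * l) <= M * Cmod (y - z) ^ 2)%R) ->
  is_cderive f z l.
Proof.
intros Hd H. apply is_cderive_eps. intros eps Heps.
(* The sign of [M] is not prescribed; |M| + 1 is a positive upper bound by which one can divide. *)
assert (HM : (0 < Rabs M + 1)%R) by (pose proof (Rabs_pos M); lra).
exists (Rmin delta (eps / (Rabs M + 1))). split.
- apply Rmin_pos; [assumption | now apply Rdiv_lt_0_compat].
- intros y Hy.
  assert (H1 := Rlt_le_trans _ _ _ Hy (Rmin_l _ _)).
  assert (H2 := Rlt_le_trans _ _ _ Hy (Rmin_r _ _)).
  apply Rlt_div_r in H2; [|assumption].
  pose proof (Cmod_ge_0 (y - z)). pose proof (Rle_abs M).
  eapply Rle_trans; [now apply H|]. nra.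
Qed.

Lemma is_cderive_unique (f : C -> C) (z l1 l2 : C) :
  is_cderive f z l1 -> is_cderive f z l2 -> l1 = l2.
Proof.
intros H1 H2. apply is_C_derive_unique in H1, H2. congruence.
Qed.

(** The remainder equals (y - z)^2 / (z^2 y), and |y| is at least |z| / 2 as soon as y is within |z|
    / 2 of z. *)
Lemma is_cderive_inv (z : C) : z <> 0 -> is_cderive Cinv z (- / (z * z)).
Proof.
intros Hz. assert (Hm : (0 < Cmod z)%R) by now apply Cmod_gt_0.
apply (is_cderive_quadratic _ _ _ (2 / Cmod z ^ 3) (Cmod z / 2)); [lra|].
intros y Hy.
assert (Hy2 : (Cmod z / 2 <= Cmod y)%R).
{ pose proof (Cmod_triangle y (- (y - z))).
  replace (y + - (y - z)) with z in H by ring.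
  rewrite Cmod_opp in H. lra. }
assert (Hy0 : y <> 0) by (apply Cmod_gt_0; lra).
replace (/ y - / z - (y - z) * - / (z * z))
  with ((y - z) * (y - z) * (/ (z * z) * / y)) by (field; auto).
rewrite !Cmod_mult, !Cmod_inv, Cmod_mult by (auto; now apply Cmult_neq_0).
pose proof (Cmod_ge_0 (y - z)).
assert (/ Cmod y <= 2 / Cmod z)%R.
{ replace (2 / Cmod z)%R with (/ (Cmod z / 2))%R by (field; lra).
  apply Rinv_le_contravar; lra. }
replace (2 / Cmod z ^ 3 * Cmod (y - z) ^ 2)%R with
  (Cmod (y - z) * Cmod (y - z) * (/ (Cmod z * Cmod z) * (2 / Cmod z)))%R
  by (field; lra).
apply Rmult_le_compat_l; [nra|].
apply Rmult_le_compat_l; [|assumption].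
left. apply Rinv_0_lt_compat. nra.
Qed.

(** * The complex exponential: surjectivity and derivative *)

Lemma Cmod_le_abs (c : C) : (Cmod c <= Rabs (fst c) + Rabs (snd c))%R.
Proof.
destruct c as [a b]. simpl.
replace (a, b) with (RtoC a + Ci * RtoC b)
  by (apply injective_projections; simpl; ring).
eapply Rle_trans; [apply Cmod_triangle|].
rewrite Cmod_mult, !Cmod_R, Cmod_Ci. lra.
Qed.

Lemma cexp_0 : cexp 0 = 1.
Proof.
unfold cexp. simpl. rewrite exp_0, cos_0, sin_0.
apply injective_projections; simpl; ring.
Qed.

Lemma cexp_plus (a b : C) : cexp (a + b) = cexp a * cexp b.
Proof.
unfold cexp. simpl. rewrite exp_plus, cos_plus, sin_plus.
apply injective_projections; simpl; ring.
Qed.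

Lemma cexp_neq_0 (a : C) : cexp a <> 0.
Proof.
intros H. assert (H1 : cexp (a + - a) = 0) by (rewrite cexp_plus, H; ring).
replace (a + - a) with (RtoC 0) in H1 by ring. rewrite cexp_0 in H1.
injection H1. lra.
Qed.

Lemma Cmod_cexp (a : C) : Cmod (cexp a) = exp (fst a).
Proof.
unfold cexp, Cmod. simpl fst. simpl snd.
replace ((exp (fst a) * cos (snd a)) ^ 2 + (exp (fst a) * sin (snd a)) ^ 2)%R
  with (Rsqr (exp (fst a))).
- apply sqrt_Rsqr. left. apply exp_pos.
- pose proof (sin2_cos2 (snd a)). unfold Rsqr in *. nra.
Qed.

(** Polar coordinates: the preimage has real part ln |w| and imaginary part an argument of w. *)
Lemma cexp_surj (w : C) : w <> 0 -> exists t : C, cexp t = w.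
Proof.
intros Hw. apply Cmod_gt_0 in Hw.
set (r := Cmod w) in *.
set (a := (fst w / r)%R). set (b := (snd w / r)%R).
assert (Hr : (r * r = fst w * fst w + snd w * snd w)%R).
{ unfold r, Cmod. rewrite sqrt_sqrt; nra. }
assert (Hab : (a * a + b * b = 1)%R).
{ unfold a, b.
  replace 1%R with ((r * r) / (r * r))%R by (field; lra).
  rewrite Hr at 1. field. lra. }
assert (Ha : (-1 <= a <= 1)%R) by nra.
assert (exists th, cos th = a /\ sin th = b) as [th [Hc Hs]].
(* [acos] only gives angles with nonnegative sine, so a negative imaginary part calls for the
   opposite angle. *)
{ destruct (Rle_dec 0 b) as [Hb|Hb].
  - exists (acos a). rewrite cos_acos, sin_acos by assumption.
    split; [reflexivity|].
    replace (1 - Rsqr a)%R with (Rsqr b) by (unfold Rsqr; lra).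
    now apply sqrt_Rsqr.
  - exists (- acos a)%R. rewrite cos_neg, sin_neg, cos_acos, sin_acos
      by assumption.
    split; [reflexivity|].
    replace (1 - Rsqr a)%R with (Rsqr (- b)) by (unfold Rsqr; lra).
    rewrite sqrt_Rsqr; lra. }
exists (ln r, th). unfold cexp. simpl. rewrite exp_ln, Hc, Hs by assumption.
unfold a, b. apply injective_projections; simpl; field; lra.
Qed.

(** The inequality 1 + x <= e^x, taken at a and at -a, traps e^a between 1 + a and 1 / (1 - a), and
    the gap a^2 / (1 - a) is at most 2 a^2 in this range. *)
Lemma exp_quadratic (a : R) :
  (Rabs a <= 1 / 2 -> Rabs (exp a - 1 - a) <= 2 * a ^ 2)%R.
Proof.
intros Ha. apply Rabs_le_between in Ha.
assert (H1 := exp_ineq1_le a). assert (H2 := exp_ineq1_le (- a)).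
rewrite exp_Ropp in H2. assert (H3 := exp_pos a).
assert (H4 : (exp a * (1 - a) <= 1)%R).
{ apply Rmult_le_compat_l with (r := exp a) in H2; [|lra].
  rewrite Rinv_r in H2 by lra. lra. }
rewrite Rabs_pos_eq by lra. nra.
Qed.

Lemma sin_abs_le (b : R) : (Rabs (sin b) <= Rabs b)%R.
Proof.
assert (H := bounded_variation sin cos 1 0 b).
rewrite sin_0, !Rminus_0_r, Rmult_1_l in H. apply H.
intros t _. split; [apply is_derive_sin|].
apply Rabs_le, COS_bound.
Qed.

(** Between 0 and b the derivative is bounded by |b|, thanks to the linear bound on the sine; the
    mean value inequality supplies the second factor |b|. *)
Lemma cos_quadratic (b : R) : (Rabs (cos b - 1) <= b ^ 2)%R.
Proof.
assert (H := bounded_variation cos (fun x => (- sin x)%R) (Rabs b) 0 b).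
rewrite cos_0, Rminus_0_r in H.
replace (b ^ 2)%R with (Rabs b * Rabs b)%R
  by (rewrite <- Rabs_mult, Rabs_pos_eq; nra).
apply H. intros t Ht. split; [apply is_derive_cos|].
rewrite Rabs_Ropp. eapply Rle_trans; [apply sin_abs_le|].
now rewrite Rminus_0_r in Ht.
Qed.

(** The derivative cos t - 1 is bounded by t^2, and |b| <= 1 makes this at most |b|. *)
Lemma sin_quadratic (b : R) : (Rabs b <= 1 -> Rabs (sin b - b) <= b ^ 2)%R.
Proof.
intros Hb.
assert (H := bounded_variation (fun x => (sin x - x)%R)
  (fun x => (cos x - 1)%R) (Rabs b) 0 b).
cbv beta in H. rewrite sin_0, !Rminus_0_r in H.
replace (b ^ 2)%R with (Rabs b * Rabs b)%R
  by (rewrite <- Rabs_mult, Rabs_pos_eq; nra).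
apply H. intros t Ht. rewrite Rminus_0_r in Ht. split.
- apply (is_derive_minus (K := R_AbsRing) (V := R_NormedModule) sin (fun x => x)).
  + apply is_derive_sin.
  + apply (is_derive_id (K := R_AbsRing) t).
- eapply Rle_trans; [apply cos_quadratic|].
  rewrite <- (Rabs_pos_eq (t ^ 2)) by nra. rewrite <- RPow_abs.
  pose proof (Rabs_pos t). nra.
Qed.

Lemma cexp_quadratic (h : C) :
  (Cmod h <= 1 / 2 -> Cmod (cexp h - 1 - h) <= 8 * Cmod h ^ 2)%R.
Proof.
intros Hh. destruct h as [a b].
assert (Ha : (Rabs a <= Cmod (a, b))%R) by apply (re_le_Cmod (a, b)).
assert (Hb : (Rabs b <= Cmod (a, b))%R).
{ eapply Rle_trans; [apply Rmax_r|apply (Rmax_Cmod (a, b))]. }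
assert (He := exp_quadratic a ltac:(lra)).
assert (Hc := cos_quadratic b).
assert (Hs := sin_quadratic b ltac:(lra)).
assert (Hs' := sin_abs_le b).
assert (Hc' : (Rabs (cos b) <= 1)%R) by apply Rabs_le, COS_bound.
set (m := Cmod (a, b)) in *.
assert (Ha2 : (a ^ 2 <= m ^ 2)%R)
  by (rewrite <- (pow2_abs a); pose proof (Rabs_pos a); nra).
assert (Hb2 : (b ^ 2 <= m ^ 2)%R)
  by (rewrite <- (pow2_abs b); pose proof (Rabs_pos b); nra).
eapply Rle_trans; [apply Cmod_le_abs|]. unfold cexp. simpl fst. simpl snd.
(* Both components are expressed through the real remainders of exp, cos and sin. The five resulting
   terms contribute at most 2, 3/2, 1, 1 and 1 times m^2, which stays below 8 m^2. *)
replace (exp a * cos b + - (1) + - a)%R with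
  ((exp a - 1 - a) * cos b + (1 + a) * (cos b - 1))%R by ring.
replace (exp a * sin b + - 0 + - b)%R with
  ((exp a - 1 - a) * sin b + a * sin b + (sin b - b))%R by ring.
assert (T1 := Rabs_triang ((exp a - 1 - a) * cos b) ((1 + a) * (cos b - 1))).
assert (T2 := Rabs_triang ((exp a - 1 - a) * sin b + a * sin b) (sin b - b)).
assert (T3 := Rabs_triang ((exp a - 1 - a) * sin b) (a * sin b)).
assert (T4 := Rabs_triang 1 a). rewrite Rabs_R1 in T4.
rewrite !Rabs_mult in *.
pose proof (Rabs_pos (exp a - 1 - a)). pose proof (Rabs_pos (cos b)).
pose proof (Rabs_pos (cos b - 1)). pose proof (Rabs_pos (sin b)).
pose proof (Rabs_pos (1 + a)). pose proof (Rabs_pos a). pose proof (Rabs_pos b).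
assert (Rabs (exp a - 1 - a) * Rabs (cos b) <= 2 * m ^ 2)%R by nra.
assert (Rabs (1 + a) * Rabs (cos b - 1) <= 3 / 2 * m ^ 2)%R by nra.
assert (Rabs (exp a - 1 - a) * Rabs (sin b) <= m ^ 2)%R by nra.
assert (Rabs a * Rabs (sin b) <= m ^ 2)%R by nra.
lra.
Qed.

(** The functional equation factors out e^z and reduces the claim to the estimate at the origin. *)
Lemma is_cderive_cexp (z : C) : is_cderive cexp z (cexp z).
Proof.
apply (is_cderive_quadratic _ _ _ (Cmod (cexp z) * 8) (1 / 2)); [lra|].
intros y Hy.
replace (cexp y) with (cexp z * cexp (y - z))
  by (rewrite <- cexp_plus; f_equal; ring).
replace (cexp z * cexp (y - z) - cexp z - (y - z) * cexp z)
  with (cexp z * (cexp (y - z) - 1 - (y - z))) by ring.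
rewrite Cmod_mult, Rmult_assoc.
apply Rmult_le_compat_l; [apply Cmod_ge_0|]. apply cexp_quadratic. lra.
Qed.

(** * A mean value inequality in the plane *)

Lemma is_derive_along_segment (f : C -> C) (b l : C) (r : R) :
  is_cderive f (RtoC r * b) l ->
  is_derive (fun x : R => fst (f (RtoC x * b))) r (fst (b * l)) /\
  is_derive (fun x : R => snd (f (RtoC x * b))) r (snd (b * l)).
Proof.
intros H.
assert (H' : forall eps : R, (0 < eps)%R -> exists delta : posreal,
  forall h : R, h <> 0%R -> (Rabs h < delta)%R ->
  (Cmod (f (RtoC (r + h) * b)%C - f (RtoC r * b)%C - RtoC h * (b * l))
     < eps * Rabs h)%R).
{ intros eps Heps. rewrite is_cderive_eps in H.
  pose proof (Cmod_ge_0 b) as Hb.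
  (* Moving by h along the line moves the argument by h b; dividing by |b| + 1 absorbs the factor
     |b|, makes the bound strict and allows b = 0. *)
  destruct (H (eps / (Cmod b + 1))%R) as [d [Hd H1]].
  { apply Rdiv_lt_0_compat; lra. }
  assert (Hd' : (0 < d / (Cmod b + 1))%R) by (apply Rdiv_lt_0_compat; lra).
  exists (mkposreal _ Hd'). simpl. intros h Hh0 Hh.
  apply Rlt_div_r in Hh; [|lra].
  assert (E : RtoC (r + h) * b - RtoC r * b = RtoC h * b)
    by (rewrite RtoC_plus; ring).
  specialize (H1 (RtoC (r + h) * b)).
  rewrite E, Cmod_mult, Cmod_R, <- Cmult_assoc in H1.
  pose proof (Rabs_pos_lt h Hh0).
  eapply Rle_lt_trans; [apply H1; nra|].
  replace (eps / (Cmod b + 1) * (Rabs h * Cmod b))%R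
    with (eps * Rabs h * (Cmod b / (Cmod b + 1)))%R by (field; lra).
  assert (Cmod b / (Cmod b + 1) < 1)%R by (apply Rlt_div_l; lra).
  assert (0 < eps * Rabs h)%R by nra. nra. }
(* Any real function whose increment error is dominated by the complex one is differentiable; this
   serves for both components. *)
assert (D : forall (g : R -> R) (m : R),
  (forall h : R, (Rabs (g (r + h) - g r - h * m) <=
     Cmod (f (RtoC (r + h) * b)%C - f (RtoC r * b)%C - RtoC h * (b * l)))%R) ->
  is_derive g r m).
{ intros g m Hg. apply is_derive_Reals. intros eps Heps.
  destruct (H' eps Heps) as [d Hd]. exists d. intros h Hh0 Hh.
  replace ((g (r + h) - g r) / h - m)%R
    with ((g (r + h) - g r - h * m) / h)%R by (now field).
  rewrite Rabs_div by assumption.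
  apply Rlt_div_l; [now apply Rabs_pos_lt|].
  eapply Rle_lt_trans; [apply Hg|]. now apply Hd. }
split; apply D; intros h.
- eapply Rle_trans; [|apply re_le_Cmod]. apply Req_le. f_equal.
  unfold Re. simpl. ring.
- eapply Rle_trans; [|eapply Rle_trans; [apply Rmax_r|apply Rmax_Cmod]].
  apply Req_le. f_equal. simpl. ring.
Qed.

(** The real inequality is applied to each component along the segment from 0 to b; adding the two
    bounds costs the factor 2. *)
Lemma C_mean_value_bound (f df : C -> C) (b : C) (M : R) :
  (forall z : C, (Cmod z <= Cmod b)%R ->
     is_cderive f z (df z) /\ (Cmod (df z) <= M)%R) ->
  (Cmod (f b - f 0) <= 2 * M * Cmod b)%R.
Proof.
intros H.
assert (Hseg : forall t : R, (Rabs (t - 0) <= Rabs (1 - 0))%R ->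
  is_cderive f (RtoC t * b) (df (RtoC t * b)) /\
  (Cmod (b * df (RtoC t * b)%C) <= M * Cmod b)%R).
{ intros t Ht. rewrite !Rminus_0_r, Rabs_R1 in Ht.
  destruct (H (RtoC t * b)) as [H1 H2].
  - rewrite Cmod_mult, Cmod_R. pose proof (Cmod_ge_0 b). nra.
  - split; [exact H1|]. rewrite Cmod_mult. pose proof (Cmod_ge_0 b). nra. }
assert (B1 := bounded_variation (fun t => fst (f (RtoC t * b)))
  (fun t => fst (b * df (RtoC t * b))) (M * Cmod b) 0 1).
assert (B2 := bounded_variation (fun t => snd (f (RtoC t * b)))
  (fun t => snd (b * df (RtoC t * b))) (M * Cmod b) 0 1).
cbv beta in B1, B2.
rewrite Cmult_0_l, Cmult_1_l, !Rminus_0_r, Rabs_R1, Rmult_1_r in B1, B2.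
eapply Rle_trans; [apply Cmod_le_abs|].
replace (2 * M * Cmod b)%R with (M * Cmod b + M * Cmod b)%R by ring.
apply Rplus_le_compat; [apply B1 | apply B2]; intros t Ht;
  rewrite Rminus_0_r in Ht;
  destruct (Hseg t ltac:(now rewrite !Rminus_0_r, Rabs_R1)) as [H1 H2];
  destruct (is_derive_along_segment f b _ t H1) as [D1 D2].
- split; [exact D1|]. eapply Rle_trans; [apply re_le_Cmod|exact H2].
- split; [exact D2|].
  eapply Rle_trans; [eapply Rle_trans; [apply Rmax_r|apply Rmax_Cmod]|exact H2].
Qed.

Lemma cderive_zero_const (f : C -> C) :
  (forall z : C, is_cderive f z (RtoC 0)) -> forall z : C, f z = f 0.
Proof.
intros H z.
assert (B : (Cmod (f z - f 0) <= 2 * 0 * Cmod z)%R).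
{ apply (C_mean_value_bound f (fun _ => RtoC 0)). intros y _.
  split; [apply H|]. rewrite Cmod_0. lra. }
assert (E : f z - f 0 = 0).
{ apply Cmod_eq_0. pose proof (Cmod_ge_0 (f z - f 0)). lra. }
replace (f z) with (f z - f 0 + f 0) by ring. rewrite E. ring.
Qed.
(* Coquelicot endows [C] with two normed module structures over itself, which
   are not convertible: the generic one on an absolute-value ring, and
   [C_NormedModule], whose topology is that of [R * R]. *)
Lemma filterdiff_C_AbsRing (U : NormedModule C_AbsRing) (f : U -> C)
  (F : (U -> Prop) -> Prop) (l : U -> C) :
  filterdiff (V := AbsRing_NormedModule C_AbsRing) f F l <->
  filterdiff (V := C_NormedModule) f F l.
Proof.
split; intros [[L1 L2 L3] H]; (split; [constructor; assumption | exact H]).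
Qed.

(** * Rules of complex differentiation *)

Lemma is_cderive_eq (f : C -> C) (x l l' : C) :
  is_cderive f x l -> l = l' -> is_cderive f x l'.
Proof. now intros H <-. Qed.

Lemma is_cderive_ext (f g : C -> C) (x l : C) :
  (forall y : C, f y = g y) -> is_cderive f x l -> is_cderive g x l.
Proof. exact (is_derive_ext (V := C_NormedModule) f g x l). Qed.

Lemma is_cderive_const (a x : C) : is_cderive (fun _ => a) x (RtoC 0).
Proof. apply (is_derive_const (K := C_AbsRing) (V := C_NormedModule)). Qed.

Lemma is_cderive_id (x : C) : is_cderive (fun y => y) x (RtoC 1).
Proof. apply filterdiff_C_AbsRing, (is_derive_id (K := C_AbsRing) x). Qed.

Lemma is_cderive_minus (f g : C -> C) (x df dg : C) :
  is_cderive f x df -> is_cderive g x dg ->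
  is_cderive (fun y => f y - g y) x (df - dg).
Proof. apply (is_derive_minus (K := C_AbsRing) (V := C_NormedModule)). Qed.

Lemma is_cderive_plus (f g : C -> C) (x df dg : C) :
  is_cderive f x df -> is_cderive g x dg ->
  is_cderive (fun y => f y + g y) x (df + dg).
Proof. apply (is_derive_plus (K := C_AbsRing) (V := C_NormedModule)). Qed.

Lemma is_cderive_mult (f g : C -> C) (x df dg : C) :
  is_cderive f x df -> is_cderive g x dg ->
  is_cderive (fun y => f y * g y) x (df * g x + f x * dg).
Proof.
intros Hf Hg. apply filterdiff_C_AbsRing in Hf, Hg. apply filterdiff_C_AbsRing.
apply (is_derive_mult (K := C_AbsRing) f g x df dg Hf Hg).
exact Cmult_comm.
Qed.

Lemma is_cderive_scal (a : C) (f : C -> C) (x df : C) :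
  is_cderive f x df -> is_cderive (fun y => a * f y) x (a * df).
Proof.
intros H. eapply is_cderive_eq.
- apply (is_cderive_mult (fun _ => a) f); [apply is_cderive_const|exact H].
- cbv beta. ring.
Qed.

Lemma is_cderive_comp (f g : C -> C) (x df dg : C) :
  is_cderive f (g x) df -> is_cderive g x dg ->
  is_cderive (fun y => f (g y)) x (dg * df).
Proof.
intros Hf Hg. apply filterdiff_C_AbsRing in Hg.
exact (is_derive_comp (K := C_AbsRing) (V := C_NormedModule) f g x df dg Hf Hg).
Qed.

Lemma is_cderive_half_square (x : C) : is_cderive (fun y => y * y / 2) x x.
Proof.
eapply is_cderive_eq.
- apply (is_cderive_mult (fun y => y * y) (fun _ => / 2)).
  + apply (is_cderive_mult (fun y => y) (fun y => y)); apply is_cderive_id.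
  + apply is_cderive_const.
- cbv beta. field.
Qed.

(** * The function (e^x - 1) / x and the cubic estimate at its singularity *)

Definition expm1_div (x : C) : C :=
  if Ceq_dec x 0 then RtoC 1 else (cexp x - 1) / x.

Lemma mult_expm1_div (x : C) : x * expm1_div x = cexp x - 1.
Proof.
unfold expm1_div. destruct (Ceq_dec x 0) as [->|Hx].
- rewrite cexp_0. ring.
- now field.
Qed.

Lemma expm1_div_0 : expm1_div 0 = 1.
Proof. unfold expm1_div. now destruct (Ceq_dec 0 0). Qed.

(** On the unit disc |e^z| <= 3, and three uses of the mean value inequality raise the order by one
    each time, with constants 6, 12 and 24. Order three is required because [expm1_div] divides by y
    and must still keep a quadratic remainder at 0. *)
Lemma cexp_cubic (y : C) :
  (Cmod y <= 1 ->
   Cmod (cexp y - 1 - y - y * y / 2) <= 24 * Cmod y ^ 3)%R.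
Proof.
intros Hy.
assert (D0 : forall x, is_cderive (fun x => cexp x - 1) x (cexp x)).
{ intros x. eapply is_cderive_eq.
  - apply (is_cderive_minus cexp (fun _ => RtoC 1));
      [apply is_cderive_cexp | apply is_cderive_const].
  - ring. }
assert (D1 : forall x, is_cderive (fun x => cexp x - 1 - x) x (cexp x - 1)).
{ intros x. apply (is_cderive_minus _ (fun y => y));
    [apply D0 | apply is_cderive_id]. }
assert (D2 : forall x,
  is_cderive (fun x => cexp x - 1 - x - x * x / 2) x (cexp x - 1 - x)).
{ intros x. apply (is_cderive_minus _ (fun x => x * x / 2));
    [apply D1 | apply is_cderive_half_square]. }
assert (B0 : forall z : C, (Cmod z <= 1)%R ->
  (Cmod (cexp z - 1) <= 6 * Cmod z)%R).
{ intros z Hz. rewrite <- cexp_0.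
  replace 6%R with (2 * 3)%R by ring.
  apply (C_mean_value_bound cexp cexp). intros x Hx.
  split; [apply is_cderive_cexp|]. rewrite Cmod_cexp.
  eapply Rle_trans; [|apply exp_le_3].
  assert (H := re_le_Cmod x). unfold Re in H.
  pose proof (Rle_abs (fst x)).
  destruct (Rle_lt_or_eq_dec (fst x) 1 ltac:(lra)) as [H1|H1].
  - left. now apply exp_increasing.
  - rewrite H1. apply Rle_refl. }
assert (B1 : forall z : C, (Cmod z <= 1)%R ->
  (Cmod (cexp z - 1 - z) <= 12 * Cmod z ^ 2)%R).
{ intros z Hz.
  assert (H := C_mean_value_bound (fun x => cexp x - 1 - x)
    (fun x => cexp x - 1) z (6 * Cmod z)).
  cbv beta in H. rewrite cexp_0 in H.
  replace (cexp z - 1 - z) with (cexp z - 1 - z - (1 - 1 - 0)) by ring.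
  replace (12 * Cmod z ^ 2)%R with (2 * (6 * Cmod z) * Cmod z)%R by ring.
  apply H. intros x Hx. split; [apply D1|].
  eapply Rle_trans; [apply B0; lra|]. lra. }
assert (H := C_mean_value_bound (fun x => cexp x - 1 - x - x * x / 2)
    (fun x => cexp x - 1 - x) y (12 * Cmod y ^ 2)).
cbv beta in H. rewrite cexp_0 in H.
replace (cexp y - 1 - y - y * y / 2)
  with (cexp y - 1 - y - y * y / 2 - (1 - 1 - 0 - 0 * 0 / 2))
  by field.
replace (24 * Cmod y ^ 3)%R with (2 * (12 * Cmod y ^ 2) * Cmod y)%R by ring.
apply H. intros x Hx. split; [apply D2|].
eapply Rle_trans; [apply B1; lra|].
pose proof (Cmod_ge_0 x). nra.
Qed.

(** * Local consequences of differentiability, and entire functions *)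

Lemma ex_cderive_ext_loc (f g : C -> C) (p : C) :
  locally p (fun z => f z = g z) -> ex_cderive f p -> ex_cderive g p.
Proof.
intros H. apply ex_derive_ext_loc. now apply locally_C.
Qed.

Lemma ex_cderive_cont (f : C -> C) (p : C) :
  ex_cderive f p -> forall eps : R, (0 < eps)%R ->
  locally p (fun z => (Cmod (f z - f p) < eps)%R).
Proof.
intros [l H] eps Heps. apply locally_Cmod.
rewrite is_cderive_eps in H. destruct (H 1%R Rlt_0_1) as [d [Hd H1]].
pose proof (Cmod_ge_0 l).
assert (Hd' : (0 < eps / (Cmod l + 2))%R) by (apply Rdiv_lt_0_compat; lra).
exists (Rmin d (eps / (Cmod l + 2))). split; [now apply Rmin_pos|].
intros y Hy.
assert (Hy1 := Rlt_le_trans _ _ _ Hy (Rmin_l _ _)).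
assert (Hy2 := Rlt_le_trans _ _ _ Hy (Rmin_r _ _)).
apply Rlt_div_r in Hy2; [|lra].
specialize (H1 y Hy1).
replace (f y - f p) with ((f y - f p - (y - p) * l) + (y - p) * l) by ring.
pose proof (Cmod_triangle (f y - f p - (y - p) * l) ((y - p) * l)) as T.
rewrite (Cmod_mult (y - p) l) in T.
pose proof (Cmod_ge_0 (y - p)). nra.
Qed.

Lemma locally_neq_0 (f : C -> C) (p : C) :
  ex_cderive f p -> f p <> 0 -> locally p (fun z => f z <> 0).
Proof.
intros Hf Hp. apply Cmod_gt_0 in Hp.
apply filter_imp with (2 := ex_cderive_cont f p Hf _ Hp).
intros z Hz E. rewrite E in Hz.
replace (0 - f p) with (- f p) in Hz by ring. rewrite Cmod_opp in Hz. lra.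
Qed.

(** By continuity a nonzero value at p would persist nearby, against the vanishing at points other
    than p. This extends identities across isolated points. *)
Lemma punctured_zero_at (f : C -> C) (p : C) :
  ex_cderive f p -> locally' p (fun z => f z = 0) -> f p = 0.
Proof.
intros Hf H. destruct (Ceq_dec (f p) 0) as [E|E]; [exact E|exfalso].
assert (L := filter_and _ _ (locally_neq_0 f p Hf E) H).
apply locally_Cmod in L. destruct L as [d [Hd L]].
assert (Hne : RtoC (d / 2) <> 0) by (intros F; injection F; lra).
destruct (L (p + RtoC (d / 2))) as [L1 L2].
- replace (p + RtoC (d / 2) - p) with (RtoC (d / 2)) by ring.
  rewrite Cmod_R, Rabs_pos_eq; lra.
- apply L1, L2. intros F. apply Hne.
  replace (RtoC (d / 2)) with (p + RtoC (d / 2) - p) by ring.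
  rewrite F. ring.
Qed.

Lemma ex_cderive_minus (f g : C -> C) (p : C) :
  ex_cderive f p -> ex_cderive g p -> ex_cderive (fun z => f z - g z) p.
Proof.
intros [a Ha] [b Hb]. exists (a - b). now apply is_cderive_minus.
Qed.

Lemma ex_cderive_plus (f g : C -> C) (p : C) :
  ex_cderive f p -> ex_cderive g p -> ex_cderive (fun z => f z + g z) p.
Proof.
intros [a Ha] [b Hb]. exists (a + b). now apply is_cderive_plus.
Qed.

Lemma ex_cderive_mult (f g : C -> C) (p : C) :
  ex_cderive f p -> ex_cderive g p -> ex_cderive (fun z => f z * g z) p.
Proof.
intros [a Ha] [b Hb]. eexists. apply is_cderive_mult; eassumption.
Qed.

Lemma ex_cderive_comp (f g : C -> C) (p : C) :
  ex_cderive f (g p) -> ex_cderive g p -> ex_cderive (fun z => f (g z)) p.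
Proof.
intros [a Ha] [b Hb]. eexists. apply is_cderive_comp; eassumption.
Qed.

Lemma ex_cderive_div (f g : C -> C) (p : C) :
  ex_cderive f p -> ex_cderive g p -> g p <> 0 ->
  ex_cderive (fun z => f z / g z) p.
Proof.
intros Hf Hg Hp. apply (ex_cderive_mult f (fun z => / g z)); [exact Hf|].
apply (ex_cderive_comp Cinv g); [|exact Hg].
eexists. now apply is_cderive_inv.
Qed.

Lemma entire_cexp : entire cexp.
Proof. intros z. eexists. apply is_cderive_cexp. Qed.

Lemma entire_expm1_div : entire expm1_div.
Proof.
intros z. destruct (Ceq_dec z 0) as [->|Hz].
(* The Taylor series 1 + x / 2 + ... gives the derivative 1/2 at 0; after multiplication by |y| the
   required bound is [cexp_cubic], whence the constant 24. *)
- exists (/ 2). apply (is_cderive_quadratic _ _ _ 24 1); [lra|].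
  intros y Hy. rewrite expm1_div_0.
  replace (y - 0) with y in * by ring.
  destruct (Ceq_dec y 0) as [->|Hy0].
  { rewrite expm1_div_0. replace (1 - 1 - 0 * / 2) with (RtoC 0) by ring.
    rewrite Cmod_0. lra. }
  assert (Hm : (0 < Cmod y)%R) by now apply Cmod_gt_0.
  apply Rmult_le_reg_l with (Cmod y); [exact Hm|].
  rewrite <- Cmod_mult.
  replace (y * (expm1_div y - 1 - y * / 2))
    with (y * expm1_div y - y - y * y / 2)
    by field.
  rewrite mult_expm1_div.
  replace (Cmod y * (24 * Cmod y ^ 2))%R with (24 * Cmod y ^ 3)%R by ring.
  apply cexp_cubic. lra.
- apply (ex_cderive_ext_loc (fun x => (cexp x - 1) / x)).
  + apply (filter_imp (fun x : C => x <> 0)).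
    * intros x Hx. unfold expm1_div. now destruct (Ceq_dec x 0).
    * apply (locally_neq_0 (fun x => x)); [|exact Hz].
      eexists. apply is_cderive_id.
  + apply ex_cderive_div; [|eexists; apply is_cderive_id|exact Hz].
    apply ex_cderive_minus; [apply entire_cexp|].
    eexists. apply is_cderive_const.
Qed.

(** * Linear differential equations with constant coefficients *)

Lemma is_cderive_cexp_scal (a t : C) :
  is_cderive (fun x => cexp (a * x)) t (a * cexp (a * t)).
Proof.
eapply is_cderive_eq.
- apply (is_cderive_comp cexp (fun x => a * x)); [apply is_cderive_cexp|].
  apply (is_cderive_scal a (fun x => x)), is_cderive_id.
- ring.
Qed.

(** The function is the primitive of e^(a x) vanishing at 0: it is (e^(a x) - 1) / a for nonzero a,
    and x for a = 0. *)
Lemma is_cderive_expm1_div_scal (a t : C) :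
  is_cderive (fun x => x * expm1_div (a * x)) t (cexp (a * t)).
Proof.
destruct (Ceq_dec a 0) as [->|Ha].
- apply (is_cderive_ext (fun x => x)).
  + intros x. rewrite Cmult_0_l, expm1_div_0. ring.
  + rewrite Cmult_0_l, cexp_0. apply is_cderive_id.
- apply (is_cderive_ext (fun x => / a * (cexp (a * x) - 1))).
  + intros x. rewrite <- mult_expm1_div. now field.
  + eapply is_cderive_eq.
    * apply (is_cderive_scal (/ a) (fun x => cexp (a * x) - 1)).
      apply (is_cderive_minus _ (fun _ => RtoC 1));
        [apply is_cderive_cexp_scal|apply is_cderive_const].
    * now field.
Qed.

Lemma linear_ode_solution (a b w0 t : C) :
  is_cderive (fun x => w0 + (a * w0 + b) * (x * expm1_div (a * x))) t
    (a * (w0 + (a * w0 + b) * (t * expm1_div (a * t))) + b).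
Proof.
eapply is_cderive_eq.
- apply (is_cderive_plus (fun _ => w0)); [apply is_cderive_const|].
  apply is_cderive_scal, is_cderive_expm1_div_scal.
- replace (cexp (a * t)) with (a * t * expm1_div (a * t) + 1)
    by (rewrite mult_expm1_div; ring).
  ring.
Qed.

(** The difference from the explicit solution solves the homogeneous equation, so its product with
    e^(-a x) has zero derivative and vanishes at 0. Uniqueness makes the explicit formula available
    for an arbitrary flow. *)
Lemma linear_ode_unique (a b : C) (w : C -> C) :
  (forall t : C, is_cderive w t (a * w t + b)) ->
  forall t : C, w t = w 0 + (a * w 0 + b) * (t * expm1_div (a * t)).
Proof.
intros H t.
set (v := fun x : C => w 0 + (a * w 0 + b) * (x * expm1_div (a * x))).
set (d := fun x : C => (w x - v x) * cexp (- a * x)).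
assert (Hd : forall x : C, is_cderive d x (RtoC 0)).
{ intros x. eapply is_cderive_eq.
  - apply (is_cderive_mult (fun x => w x - v x) (fun x => cexp (- a * x))).
    + apply is_cderive_minus; [apply H|apply linear_ode_solution].
    + apply is_cderive_cexp_scal.
  - cbv beta. fold (v x). ring. }
assert (E := cderive_zero_const d Hd t).
replace (d 0) with (RtoC 0) in E by (unfold d, v; ring).
destruct (Ceq_dec (w t - v t) 0) as [E'|E'].
- fold (v t). replace (w t) with (w t - v t + v t) by ring.
  rewrite E'. ring.
- exfalso. now apply (Cmult_neq_0 _ _ E' (cexp_neq_0 (- a * t))).
Qed.

(** * Fréchet differentiability on the product *)

Notation ex_frechet :=
  (ex_filterdiff (K := C_AbsRing) (U := C2) (V := C_NormedModule)).

Lemma ex_frechet_comp (g : C -> C) (f : C * C -> C) (p : C * C) :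
  ex_cderive g (f p) -> ex_frechet f (locally p) ->
  ex_frechet (fun x => g (f x)) (locally p).
Proof.
intros [dg Hg] [lf Hf]. eexists.
apply filterdiff_C_AbsRing in Hf.
eapply (filterdiff_comp' (U := C2) (V := AbsRing_NormedModule C_AbsRing)
  (W := C_NormedModule)); [exact Hf|exact Hg].
Qed.

Lemma ex_frechet_minus (f g : C * C -> C) (p : C * C) :
  ex_frechet f (locally p) -> ex_frechet g (locally p) ->
  ex_frechet (fun x => f x - g x) (locally p).
Proof.
intros [lf Hf] [lg Hg]. eexists.
exact (filterdiff_minus_fct _ _ _ _ Hf Hg).
Qed.

Lemma ex_frechet_mult (f g : C * C -> C) (p : C * C) :
  ex_frechet f (locally p) -> ex_frechet g (locally p) ->
  ex_frechet (fun x => f x * g x) (locally p).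
Proof.
intros [lf Hf] [lg Hg]. apply filterdiff_C_AbsRing in Hf, Hg.
eexists. apply filterdiff_C_AbsRing.
exact (filterdiff_mult_fct _ _ _ _ _ Cmult_comm Hf Hg).
Qed.

Lemma ex_frechet_fst (p : C * C) : ex_frechet fst (locally p).
Proof. eexists. apply filterdiff_linear, is_linear_fst. Qed.

Lemma ex_frechet_snd (p : C * C) : ex_frechet snd (locally p).
Proof. eexists. apply filterdiff_linear, is_linear_snd. Qed.

Lemma filterdiff_pair (U : NormedModule C_AbsRing) (f g : U -> C) (x : U)
  (lf lg : U -> C) :
  filterdiff (V := C_NormedModule) f (locally x) lf ->
  filterdiff (V := C_NormedModule) g (locally x) lg ->
  filterdiff (V := C2) (fun y => (f y, g y)) (locally x)
    (fun y => (lf y, lg y)).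
Proof.
intros Hf Hg.
(* The pair is viewed as a composition with the pairing map, which is the identity of the
   product. *)
apply (filterdiff_comp'_2 (U := C_NormedModule) (V := C_NormedModule)
  (W := C2) f g (fun a b => (a, b)) x lf lg (fun a b => (a, b)) Hf Hg).
apply filterdiff_ext with (f := fun t : C2 => t); [now intros []|].
apply filterdiff_ext_lin with (l1 := fun t : C2 => t); [|now intros []].
apply filterdiff_id.
Qed.

Lemma is_derive_pair (f g : C -> C) (x a b : C) :
  is_cderive f x a -> is_cderive g x b ->
  is_derive (K := C_AbsRing) (V := C2) (fun t => (f t, g t)) x (a, b).
Proof. apply filterdiff_pair. Qed.

Lemma is_cderive_fst (f : C -> C * C) (x : C) (l : C * C) :
  is_derive (K := C_AbsRing) (V := C2) f x l ->
  is_cderive (fun t => fst (f t)) x (fst l).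
Proof.
intros H.
exact (filterdiff_comp' (U := AbsRing_NormedModule C_AbsRing) (V := C2)
  (W := C_NormedModule) f fst x _ _ H
  (filterdiff_linear _ is_linear_fst)).
Qed.

Lemma is_cderive_snd (f : C -> C * C) (x : C) (l : C * C) :
  is_derive (K := C_AbsRing) (V := C2) f x l ->
  is_cderive (fun t => snd (f t)) x (snd l).
Proof.
intros H.
exact (filterdiff_comp' (U := AbsRing_NormedModule C_AbsRing) (V := C2)
  (W := C_NormedModule) f snd x _ _ H
  (filterdiff_linear _ is_linear_snd)).
Qed.

(** * Principal parts, removable singularities and the graph *)

Lemma P1_div_fin (a b c : C) : P1_div a b = P1_fin c <-> b <> 0 /\ c = a / b.
Proof.
unfold P1_div. destruct (Ceq_dec b 0) as [Hb|Hb].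
- split; [discriminate|]. now intros [H _].
- split.
  + intros H. injection H as <-. now split.
  + now intros [_ ->].
Qed.

(** Subtraction cancels the common polar sum and leaves the difference of the holomorphic
    remainders. Keeping the finiteness of both values on a punctured neighbourhood later shows that
    the zeros of [q1] are isolated. *)
Lemma principal_parts_cancel (s1 s2 : C -> P1) (p : C) :
  same_principal_parts s1 s2 ->
  exists k : C -> C, holomorphic_near k p /\
    locally' p (fun z => exists c1 c2 : C,
      s1 z = P1_fin c1 /\ s2 z = P1_fin c2 /\ c2 - c1 = k z).
Proof.
intros H. destruct (H p) as [n [c [[k1 [H1 E1]] [k2 [H2 E2]]]]].
exists (fun z => k2 z - k1 z). split.
- generalize (filter_and _ _ H1 H2). unfold holomorphic_near. apply filter_imp.
  intros z [D1 D2]. now apply ex_cderive_minus.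
- assert (E := filter_and _ _ E1 E2).
  unfold locally', within in *.
  revert E. apply filter_imp. intros z E Hz.
  destruct (E Hz) as [F1 F2].
  eexists. eexists. split; [exact F1|]. split; [exact F2|]. ring.
Qed.

Lemma Cdiv_neq_0 (a b : C) : a <> 0 -> b <> 0 -> a / b <> 0.
Proof.
intros Ha Hb H. apply Ha. replace a with (a / b * b) by (now field).
rewrite H. ring.
Qed.

(** Near each point p the denominator [d] can vanish only at p, so replacing f there by the value of
    a local extension gives a function that agrees with this extension on a whole neighbourhood. *)
Lemma removable_extension (f d : C -> C) :
  entire d ->
  (forall p : C, d p <> 0 -> ex_cderive f p) ->
  (forall p : C, exists k : C -> C, holomorphic_near k p /\
     locally' p (fun z => d z <> 0 /\ f z = k z)) ->
  exists h : C -> C, entire h /\ forall z : C, d z <> 0 -> h z = f z.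
Proof.
intros Hd Hf Hk.
(* One local extension is chosen at every point; at a zero z of [d] the new value is that of the
   extension chosen at z. *)
pose (k := fun p => proj1_sig (constructive_indefinite_description _ (Hk p))).
assert (Hk' : forall p, holomorphic_near (k p) p /\
  locally' p (fun z => d z <> 0 /\ f z = k p z))
  by (intros p; exact (proj2_sig (constructive_indefinite_description _ (Hk p)))).
exists (fun z => if Ceq_dec (d z) 0 then k z z else f z). split.
- intros p. destruct (Ceq_dec (d p) 0) as [Hp|Hp].
  + destruct (Hk' p) as [H1 H2].
    apply (ex_cderive_ext_loc (k p)).
    * unfold locally', within in H2. revert H2. apply filter_imp. intros z Hz.
      destruct (Ceq_dec (d z) 0) as [E|E].
      -- destruct (Ceq_dec z p) as [->|Hne]; [reflexivity|].
         now destruct (Hz Hne).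
      -- symmetry. apply Hz. congruence.
    * exact (locally_singleton _ _ H1).
  + apply (ex_cderive_ext_loc f); [|now apply Hf].
    apply (filter_imp (fun z => d z <> 0)).
    * intros z Hz. now destruct (Ceq_dec (d z) 0).
    * now apply locally_neq_0.
- intros z Hz. now destruct (Ceq_dec (d z) 0).
Qed.

(** At a pole the equation q1 w = q would force q to vanish too, which the absence of common zeros
    excludes; so the fibre over a pole misses the zero set. *)
Lemma graph_P1_div (q q1 : C -> C) (s : C -> P1) :
  (forall z : C, ~ (q z = 0 /\ q1 z = 0)) ->
  (forall z : C, s z = P1_div (q z) (q1 z)) ->
  forall p : C * C, graph s p <-> q1 (fst p) * snd p - q (fst p) = 0.
Proof.
intros Hcz Hs [z w]. unfold graph. simpl. rewrite Hs, P1_div_fin. split.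
- intros [H ->]. now field.
- intros H. assert (E : q z = q1 z * w).
  { replace (q z) with (q1 z * w - (q1 z * w - q z)) by ring.
    rewrite H. ring. }
  assert (H1 : q1 z <> 0).
  { intros H1. apply (Hcz z). split; [|exact H1]. rewrite E, H1. ring. }
  split; [exact H1|]. rewrite E. now field.
Qed.

Lemma open_nonzero (f : C * C -> C) :
  holomorphic2 (V := C_NormedModule) f -> open (fun p => f p <> 0).
Proof.
intros Hf p Hp.
assert (Hc := filterdiff_continuous (K := C_AbsRing) (U := C2)
  (V := C_NormedModule) f p (Hf p)).
apply (Hc (fun w => w <> RtoC 0)).
apply (locally_neq_0 (fun w => w)); [|exact Hp].
eexists. apply is_cderive_id.
Qed.

(** * Integral curves of the field and the Jacobian determinant *)

Lemma Zfield_flow (q q1 u : C -> C) (gamma : C -> C * C) :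
  integral_curve (Zfield q q1 u) gamma ->
  forall t : C,
    gamma t = (fst (gamma 0), let (z, w) := gamma 0 in
      w + cexp (u z) * (q1 z * w - q z)
          * (t * expm1_div (cexp (u z) * q1 z * t))).
Proof.
intros H.
(* The field is vertical, so z is constant along the curve and the equation for w has constant
   coefficients. *)
assert (Hz : forall t, fst (gamma t) = fst (gamma 0)).
{ apply cderive_zero_const. intros t.
  exact (is_cderive_fst gamma t _ (H t)). }
intros t. destruct (gamma 0) as [z w] eqn:E0. simpl in Hz |- *.
apply injective_projections; simpl; [apply Hz|].
assert (U := linear_ode_unique (cexp (u z) * q1 z) (- (cexp (u z) * q z))
  (fun t => snd (gamma t))).
cbv beta in U. rewrite E0 in U. simpl in U. rewrite U.
- ring.
- intros x. eapply is_cderive_eq; [exact (is_cderive_snd gamma x _ (H x))|].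
  simpl. rewrite Hz. ring.
Qed.

Lemma Zfield_complete (q q1 u : C -> C) : complete_field (Zfield q q1 u).
Proof.
intros [z w].
set (a := cexp (u z) * q1 z). set (b := - (cexp (u z) * q z)).
exists (fun t => (z, w + (a * w + b) * (t * expm1_div (a * t)))). split.
- f_equal. ring.
- intros t. apply is_derive_pair; [apply is_cderive_const|].
  eapply is_cderive_eq; [apply linear_ode_solution|].
  simpl. unfold a, b. ring.
Qed.

(** The Jacobian matrix is triangular with 1 in its first corner, so the determinant is the
    derivative of F along the fibre. *)
Lemma jacobian_det_vertical (F : C * C -> C) (p : C * C) (m : C) :
  ex_frechet F (locally p) ->
  is_cderive (fun t => F (fst p, t)) (snd p) m ->
  is_jacobian_det (fun x => (fst x, F x)) p m.
Proof.
intros [l Hl] Hm. destruct p as [z t]. simpl in Hm.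
exists (fun v => (fst v, l v)). split.
- apply (filterdiff_pair C2); [apply filterdiff_linear, is_linear_fst|exact Hl].
(* The differential [l] is only known to exist; its value on (0, 1) is identified by restricting F
   to the vertical line and using uniqueness of derivatives. *)
- assert (Hc : is_derive (K := C_AbsRing) (V := C2) (fun x => (z, x)) t
      (RtoC 0, RtoC 1))
    by (apply is_derive_pair; [apply is_cderive_const|apply is_cderive_id]).
  assert (H : is_cderive (fun x => F (z, x)) t (l (RtoC 0, RtoC 1))).
  { assert (H := filterdiff_comp' (U := AbsRing_NormedModule C_AbsRing)
      (V := C2) (W := C_NormedModule) (fun x : C => (z, x)) F t _ _ Hc Hl).
    refine (filterdiff_ext_lin _ _ _ H _). intros y.
    apply (linear_scal l (proj1 Hl)). }
  rewrite (is_cderive_unique _ _ _ _ Hm H).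
  pose (a := l (RtoC 0, RtoC 1) : C). pose (b := l (RtoC 1, RtoC 0) : C).
  change (a = 1 * a - 0 * b). ring.
Qed.

(** * The entire function h and its equation *)

Lemma entire_difference (s : C -> P1) (q q1 g : C -> C) :
  entire q -> entire q1 -> entire g ->
  (forall z : C, q1 z <> 0 -> g z <> 0) ->
  (forall z : C, s z = P1_div (q z) (q1 z)) ->
  same_principal_parts (fun z => P1_div 1 (g z)) s ->
  exists h : C -> C, entire h /\
    forall z sz : C, s z = P1_fin sz -> h z = sz - 1 / g z.
Proof.
intros Hq Hq1 Hg Hg0 Hs pp.
destruct (removable_extension (fun z => q z / q1 z - 1 / g z) q1 Hq1)
  as [h [Hh E]].
- intros p Hp. apply ex_cderive_minus.
  + now apply ex_cderive_div.
  + apply ex_cderive_div; [|apply Hg|now apply Hg0].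
    eexists. apply is_cderive_const.
(* Since 1/g comes first in [pp], the holomorphic difference is s - 1/g, in the order needed. *)
- intros p. destruct (principal_parts_cancel _ _ p pp) as [k [Hk E]].
  exists k. split; [exact Hk|]. unfold locally', within in *.
  revert E. apply filter_imp. intros z E Hz.
  destruct (E Hz) as [c1 [c2 [E1 [E2 E3]]]].
  rewrite Hs in E2. apply P1_div_fin in E1, E2.
  destruct E1 as [_ ->], E2 as [F ->]. now split.
- exists h. split; [exact Hh|]. intros z sz H.
  rewrite Hs in H. apply P1_div_fin in H. destruct H as [H ->]. now apply E.
Qed.

Lemma difference_equation (s : C -> P1) (q q1 g1 g h : C -> C) :
  entire q -> entire q1 -> entire g1 -> entire h ->
  (forall z : C, s z = P1_div (q z) (q1 z)) ->
  (forall z : C, g z = q1 z / cexp (g1 z)) ->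
  same_principal_parts (fun z => P1_div 1 (g z)) s ->
  (forall z sz : C, s z = P1_fin sz -> h z = sz - 1 / g z) ->
  forall z : C, q1 z * h z - q z = - cexp (g1 z).
Proof.
intros Hq Hq1 Hg1 Hh Hs Hg pp E.
assert (E1 : forall z, q1 z <> 0 -> q1 z * h z - q z + cexp (g1 z) = 0).
{ intros z Hz. rewrite (E z (q z / q1 z)), Hg.
  - field. split; [apply cexp_neq_0|exact Hz].
  - rewrite Hs. now apply P1_div_fin. }
intros z.
enough (E2 : q1 z * h z - q z + cexp (g1 z) = 0).
{ replace (q1 z * h z - q z)
    with (q1 z * h z - q z + cexp (g1 z) - cexp (g1 z)) by ring.
  rewrite E2. ring. }
apply (punctured_zero_at (fun z => q1 z * h z - q z + cexp (g1 z))).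
- apply ex_cderive_plus.
  + apply ex_cderive_minus; [now apply ex_cderive_mult|apply Hq].
  + exact (ex_cderive_comp cexp g1 z (entire_cexp _) (Hg1 z)).
(* Finiteness of s on a punctured neighbourhood of z means that [q1] has no zero there. *)
- destruct (principal_parts_cancel _ _ z pp) as [k [_ K]].
  unfold locally', within in *. revert K. apply filter_imp. intros y K Hy.
  destruct (K Hy) as [c1 [c2 [_ [K2 _]]]].
  rewrite Hs in K2. apply P1_div_fin in K2. now apply E1.
Qed.

Theorem theorem1 (s : C -> P1)
  (s_mero : meromorphic s)
  (s_not_inf : ~ forall z : C, s z = P1_inf)
  (q q1 : C -> C)
  (q_entire : entire q) (q1_entire : entire q1)
  (q_q1_no_common_zero : forall z : C, ~ (q z = 0 /\ q1 z = 0))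
  (s_quot : forall z : C, s z = P1_div (q z) (q1 z))
  (g1 : C -> C) (g1_entire : entire g1)
  (g : C -> C) (g_def : forall z : C, g z = q1 z / cexp (g1 z))
  (pp : same_principal_parts (fun z : C => P1_div 1 (g z)) s) :
  (exists h : C -> C,
     entire h /\
     (forall z sz : C, s z = P1_fin sz -> h z = sz - 1 / g z)) /\
  forall h : C -> C,
    entire h ->
    (forall z sz : C, s z = P1_fin sz -> h z = sz - 1 / g z) ->
    (forall p : C * C, ~ (graph (fun z : C => P1_fin (h z)) p /\ graph s p)) /\
    forall u : C -> C, entire u ->
      complete_field (Zfield q q1 u) /\
      forall phi : C -> C * C -> C * C, is_flow (Zfield q q1 u) phi ->
        fiber_preserving (flow_map phi h) /\
        dominating (flow_map phi h) (fun p : C * C => ~ graph s p) /\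
        maps_onto (flow_map phi h) (fun p : C * C => ~ graph s p) /\
        exists F : C * C -> C,
          holomorphic2 (V := C_NormedModule) F /\
          (forall z t sz : C, s z = P1_fin sz ->
             F (z, t) = sz - cexp (cexp (u z) * q1 z * t) / g z) /\
          (forall z t : C, flow_map phi h (z, t) = (z, F (z, t))).
Proof.
assert (Hg0 : forall z, q1 z <> 0 -> g z <> 0).
{ intros z Hz. rewrite g_def.
  apply Cdiv_neq_0; [exact Hz|apply cexp_neq_0]. }
assert (g_entire : entire g).
{ intros z.
  apply ex_derive_ext with (f := fun z => q1 z / cexp (g1 z));
    [intros y; symmetry; apply g_def|].
  apply ex_cderive_div; [apply q1_entire| |apply cexp_neq_0].
  now apply ex_cderive_comp; [apply entire_cexp|]. }
split; [now apply (entire_difference s q q1 g)|].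
intros h h_entire Hh.
assert (Hd := difference_equation s q q1 g1 g h q_entire q1_entire g1_entire
  h_entire s_quot g_def pp Hh).
assert (Hgraph := graph_P1_div q q1 s q_q1_no_common_zero s_quot).
split.
{ intros p [H1 H2]. apply Hgraph in H2. unfold graph in H1.
  injection H1 as H1. rewrite <- H1, Hd in H2.
  apply (cexp_neq_0 (g1 (fst p))).
  replace (cexp (g1 (fst p))) with (- - cexp (g1 (fst p))) by ring.
  rewrite H2. ring. }
intros u u_entire. split; [apply Zfield_complete|].
intros phi Hphi.
(* The flow started on the graph of h carries the factor e^u (q1 h - q), here replaced by - e^u e^g1
   according to [Hd]. *)
set (F := fun p : C * C => h (fst p) - cexp (u (fst p)) * cexp (g1 (fst p)) *
  (snd p * expm1_div (cexp (u (fst p)) * q1 (fst p) * snd p))).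
assert (HF : forall z t, flow_map phi h (z, t) = (z, F (z, t))).
{ intros z t. unfold flow_map. destruct (Hphi (z, h z)) as [H0 H1].
  assert (H2 := Zfield_flow q q1 u _ H1 t). cbv beta in H2.
  simpl. rewrite H2, H0. simpl. f_equal. rewrite Hd. unfold F. simpl. ring. }
(* This is the explicit formula multiplied by [q1], hence valid over poles too. Its right-hand side
   never vanishes, so the image avoids the graph. *)
assert (HF1 : forall z t,
  q1 z * F (z, t) - q z = - (cexp (g1 z) * cexp (cexp (u z) * q1 z * t))).
{ intros z t. unfold F. simpl.
  set (x := cexp (u z) * q1 z * t).
  replace (cexp x) with (x * expm1_div x + 1)
    by (rewrite mult_expm1_div; ring).
  transitivity (q1 z * h z - q z - cexp (g1 z) * (x * expm1_div x)).
  - unfold x. ring.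
  - rewrite Hd. ring. }
assert (F_holo : holomorphic2 (V := C_NormedModule) F).
{ intros p. assert (H1 := ex_frechet_fst p). assert (H2 := ex_frechet_snd p).
  assert (Hu : ex_frechet (fun x => cexp (u (fst x))) (locally p)).
  { apply (ex_frechet_comp (fun z => cexp (u z))); [|exact H1].
    now apply ex_cderive_comp; [apply entire_cexp|]. }
  apply ex_frechet_minus; [now apply ex_frechet_comp|].
  apply ex_frechet_mult.
  - apply ex_frechet_mult; [exact Hu|].
    apply (ex_frechet_comp (fun z => cexp (g1 z))); [|exact H1].
    now apply ex_cderive_comp; [apply entire_cexp|].
  - apply ex_frechet_mult; [exact H2|].
    apply ex_frechet_comp; [apply entire_expm1_div|].
    apply ex_frechet_mult; [|exact H2].
    apply ex_frechet_mult; [exact Hu|].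
    now apply ex_frechet_comp. }
assert (F_graph : forall z t, ~ graph s (z, F (z, t))).
{ intros z t H. apply Hgraph in H. simpl in H. rewrite HF1 in H.
  apply (Cmult_neq_0 _ _ (cexp_neq_0 (g1 z))
    (cexp_neq_0 (cexp (u z) * q1 z * t))).
  match goal with |- ?a = _ => replace a with (- - a) by ring end.
  rewrite H. ring. }
repeat split.
- intros [z t]. now rewrite HF.
(* The complement of the graph is the nonvanishing locus of q1 w - q. *)
- apply open_ext with (D := fun p : C * C => q1 (fst p) * snd p - q (fst p) <> 0).
  + intros p. now rewrite Hgraph.
  + apply open_nonzero. intros p.
    assert (H1 := ex_frechet_fst p). assert (H2 := ex_frechet_snd p).
    apply ex_frechet_minus; [|now apply ex_frechet_comp].
    apply ex_frechet_mult; [now apply ex_frechet_comp|exact H2].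
- intros [z t]. rewrite HF. apply F_graph.
- intros p. destruct (F_holo p) as [l Hl]. eexists.
  apply filterdiff_ext with (f := fun x : C2 => (fst x, F x));
    [intros [z t]; now rewrite HF|].
  apply (filterdiff_pair C2);
    [apply filterdiff_linear, is_linear_fst|exact Hl].
(* At t = 0 the fibre derivative of F is - e^u e^g1, which is nonzero even if [q1] vanishes at 0, so
   the origin always serves. *)
- exists (RtoC 0, RtoC 0), (- (cexp (u 0) * cexp (g1 0))). split.
  + assert (H : is_cderive (fun t => h 0 - cexp (u 0) * cexp (g1 0) *
      (t * expm1_div (cexp (u 0) * q1 0 * t))) (RtoC 0)
      (- (cexp (u 0) * cexp (g1 0)))).
    { eapply is_cderive_eq.
      - exact (is_cderive_minus (fun _ => h 0) _ _ _ _ (is_cderive_const _ _)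
          (is_cderive_scal _ _ _ _ (is_cderive_expm1_div_scal _ _))).
      - rewrite Cmult_0_r, cexp_0. ring. }
    destruct (jacobian_det_vertical F (RtoC 0, RtoC 0)
      (- (cexp (u 0) * cexp (g1 0)))) as [l [Hl HJ]].
    * apply F_holo.
    * exact H.
    * exists l. split; [|exact HJ].
      refine (filterdiff_ext _ _ _ _ Hl). intros [z t]. now rewrite HF.
  + intros H. apply (Cmult_neq_0 _ _ (cexp_neq_0 (u 0)) (cexp_neq_0 (g1 0))).
    match goal with |- ?a = _ => replace a with (- - a) by ring end.
    rewrite H. ring.
- intros Hp. destruct p as [z w]. rewrite Hgraph in Hp. simpl in Hp.
  assert (Hu := cexp_neq_0 (u z)). assert (Hg1 := cexp_neq_0 (g1 z)).
  destruct (Ceq_dec (q1 z) 0) as [Hz|Hz].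
  (* Over a zero of [q1], F is h - e^u e^g1 t, and this affine equation is solved for t. *)
  + exists (z, (h z - w) / (cexp (u z) * cexp (g1 z))).
    rewrite HF. f_equal. unfold F. simpl.
    rewrite Hz, Cmult_0_r, Cmult_0_l, expm1_div_0. field. now split.
  (* Off the zeros of [q1], [HF1] asks for e^x = - (q1 w - q) / e^g1 with x = e^u q1 t. The
     right-hand side is nonzero since (z, w) lies off the graph. *)
  + destruct (cexp_surj (- (q1 z * w - q z) / cexp (g1 z))) as [x Hx].
    { apply Cdiv_neq_0; [|exact Hg1]. intros E. apply Hp.
      replace (q1 z * w - q z) with (- - (q1 z * w - q z)) by ring.
      rewrite E. ring. }
    exists (z, x / (cexp (u z) * q1 z)). rewrite HF. f_equal.
    assert (H := HF1 z (x / (cexp (u z) * q1 z))).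
    replace (cexp (u z) * q1 z * (x / (cexp (u z) * q1 z))) with x in H
      by (field; now split).
    rewrite Hx in H.
    set (y := F (z, x / (cexp (u z) * q1 z))) in *.
    replace y with ((q1 z * y - q z + q z) / q1 z) by (now field).
    rewrite H. field. now split.
- intros [[z t] <-]. rewrite HF. apply F_graph.
- exists F. split; [exact F_holo|]. split; [|exact HF].
  intros z t sz H. rewrite s_quot in H. apply P1_div_fin in H.
  destruct H as [Hz ->].
  (* Where s is finite, [q1] is nonzero and [HF1] can be solved for F, with s = q / q1 and 1/g =
     e^g1 / q1. *)
  replace (F (z, t)) with ((q1 z * F (z, t) - q z + q z) / q1 z) by (now field).
  rewrite HF1, g_def. field. split; [apply cexp_neq_0|exact Hz].
Qed.
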